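(* Let $\Delta\ge 0$. The following three optimal values are equal: (i) the supremum of $J(\pi)$ over all history-dependent randomized policies $\pi\in\Pi^{\rm h}$ of the original system subject to $\mathbb{P}^{\pi}(\exists t\in\{0,\ldots,T\}:\ x_t\in\mathcal{X}_{\rm a})\le\Delta$; (ii) the supremum of $J(\hat\pi)$ over all history-dependent randomized policies $\hat\pi\in\hat\Pi^{\rm h}$ of the augmented system subject to $\mathbb{P}^{\hat\pi}(\phi_T=1)\le\Delta$; (iii) the supremum of $J(\hat\pi)$ over all Markov randomized policies $\hat\pi\in\hat\Pi^{\rm m}$ of the augmented system subject to $\mathbb{P}^{\hat\pi}(\phi_T=1)\le\Delta$.
   Context: Original system. Let $T\ge1$ be an integer and let $\mathcal{X}\subset\mathbb{R}^n$, $\mathcal{A}\subset\mathbb{R}^m$, $\mathcal{W}\subset\mathbb{R}^\ell$ be nonempty Borel sets. The system is $x_{t+1}=f(x_t,a_t,w_t)$, $t=0,\ldots,T-1$, with $f:\mathcal{X}\times\mathcal{A}\times\mathcal{W}\to\mathcal{X}$ Borel measurable, state $x_t\in\mathcal{X}$, attack input $a_t\in\mathcal{A}$, and independent $\mathcal{W}$-valued random noises $w_t$ (also independent of $x_0$). The initial state has distribution $p_0$, and $p_{t+1}(dx_{t+1}|x_t,a_t)$ denotes the transition kernel induced by $f$ and the law of $w_t$. The alarm region is a Borel set $\mathcal{X}_{\rm a}\subset\mathcal{X}$; an alarm is triggered at time $t$ when $x_t\in\mathcal{X}_{\rm a}$. Policies. A history-dependent randomized policy of the original system is a tuple $\pi=(\pi_t)_{t=0}^{T-1}$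 of Borel stochastic kernels $\pi_t(da_t|x_{0:t},a_{0:t-1})$ on $\mathcal{A}$, where $x_{0:t}=(x_0,\ldots,x_t)$; the set of these is $\Pi^{\rm h}$. Such a $\pi$, with $p_0$ and the transition kernels, induces a unique probability measure $\mathbb{P}^\pi$ on trajectories $(x_0,a_0,x_1,\ldots,a_{T-1},x_T)$, with expectation $\mathbb{E}^\pi$. Augmented system. The augmented state is $(x_t,\phi_t)\in\mathcal{X}\times\{0,1\}$, where $\phi_t$ is the alarm flag: $\phi_0=1$ if $x_0\in\mathcal{X}_{\rm a}$ and $\phi_0=0$ otherwise; $x_{t+1}=f(x_t,a_t,w_t)$; and $\phi_{t+1}=1$ if $x_{t+1}\in\mathcal{X}_{\rm a}$ or $\phi_t=1$, and $\phi_{t+1}=0$ otherwise. $\hat\Pi^{\rm h}$ is the set of tuples $\hat\pi=(\hat\pi_t)_{t=0}^{T-1}$ of stochastic kernels $\hat\pi_t(da_t|x_{0:t},\phi_{0:t},a_{0:t-1})$ on $\mathcal{A}$; $\hat\Pi^{\rm m}\subset\hat\Pi^{\rm h}$ is the subset of Markov (randomized) policies, i.e. those of the form $\hat\pi_t(da_t|x_t,\phi_t)$. $\mathbb{P}^{\hat\pi}$ and $\mathbb{E}^{\hat\pi}$ denote the induced probability measure on trajectories of the augmented system and its expectation. Objective. $J(\pi)=\mathbb{E}^\pi\big[\sum_{t=0}^{T-1}g_t(x_t,a_t)+g_T(x_T)\big]$ for $\pi\in\Pi^{\rm h}$, and $J(\hat\pi)$ is the same expression with $\mathbb{E}^{\hat\pi}$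 for $\hat\pi\in\hat\Pi^{\rm h}$. Here $g_t:\mathcal{X}\times\mathcal{A}\to\mathbb{R}$ ($t<T$) and $g_T:\mathcal{X}\to\mathbb{R}$ are Borel measurable and such that, for every policy, the sum over $t$ of the expectations of the positive parts of the terms or the sum over $t$ of the expectations of their negative parts is finite, so that $J$ is well defined in $[-\infty,\infty]$ and equals the sum of the expectations of the terms. The supremum over an empty feasible set is $-\infty$. *)

(* Defs.v *)
From HB Require Import structures.
From mathcomp Require Import all_boot all_order all_algebra.
From mathcomp Require Import all_classical all_reals all_analysis.
From mathcomp Require Import measurable_realfun.

Set Implicit Arguments.
Unset Strict Implicit.
Unset Printing Implicit Defensive.

Import Order.TTheory GRing.Theory Num.Theory.
Import numFieldNormedType.Exports.

Local Open Scope classical_set_scope.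
Local Open Scope ring_scope.
Local Open Scope ereal_scope.

Definition borel_rV (R : realType) (n : nat) : Type :=
  g_sigma_algebraType (@open 'rV[R]_n).

HB.instance Definition _ (R : realType) (n : nat) :=
  Measurable.on (borel_rV R n).

Section borel_subspace.
Context (R : realType) (n : nat).

(* The proof of nonemptiness is a parameter because measurable types are
   pointed; the choice of the point plays no role. *)
Definition pointed_sub (X : set (borel_rV R n)) (X0 : X !=set0) : Type :=
  {x : borel_rV R n | x \in X}.

HB.instance Definition _ X (X0 : X !=set0) := Choice.on (pointed_sub X0).

HB.instance Definition _ X (X0 : X !=set0) :=
  isPointed.Build (pointed_sub X0) (exist _ (sval (cid X0))
    (mem_set (svalP (cid X0)))).

Definition borel_sub (X : set (borel_rV R n)) (X0 : X !=set0) : Type :=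
  g_sigma_algebra_preimageType (val : pointed_sub X0 -> borel_rV R n).

HB.instance Definition _ X (X0 : X !=set0) := Measurable.on (borel_sub X0).

End borel_subspace.

Section semidirect_product.
Context d1 d2 (T1 : measurableType d1) (T2 : measurableType d2) (R : realType).
Variables (mu : probability T1 R) (k : R.-pker T1 ~> T2).

Definition semidirect (C : set (T1 * T2)) : \bar R :=
  \int[mu]_x k x (xsection C x).

Let semidirect0 : semidirect set0 = 0.
Proof. by apply: integral0_eq => x _; rewrite xsection0 measure0. Qed.

Let semidirect_ge0 C : 0 <= semidirect C.
Proof. by apply: integral_ge0 => x _; exact: measure_ge0. Qed.

Let semidirect_sigma_additive : semi_sigma_additive semidirect.
Proof.
move=> F mF tF mUF.
have -> : semidirect (\bigcup_n F n) = \sum_(0 <= i <oo) semidirect (F i).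
  rewrite /semidirect -integral_nneseries//; last first.
    by move=> i; apply: measurable_fun_xsection_finite_kernel; rewrite inE.
  apply: eq_integral => x _; rewrite xsection_bigcup.
  apply/esym/cvg_lim => //.
  apply: (@measure_semi_sigma_additive _ _ _ (k x)).
  - by move=> i; exact: measurable_xsection.
  - exact: trivIset_xsection.
  - by apply: bigcupT_measurable => i; exact: measurable_xsection.
by apply: is_cvg_nneseries => i _ _; exact: semidirect_ge0.
Qed.

HB.instance Definition _ := isMeasure.Build _ _ _ semidirect
  semidirect0 semidirect_ge0 semidirect_sigma_additive.

Let semidirectT : semidirect setT = 1.
Proof.
rewrite /semidirect.
under eq_integral do rewrite xsectionE preimage_setT prob_kernel.
by rewrite integral_cst// mul1e; exact: probability_setT.
Qed.

HB.instance Definition _ := Measure_isProbability.Build _ _ _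
  semidirect semidirectT.

End semidirect_product.

Section kernel_pullback.
Context d0 d1 d2 (T0 : measurableType d0) (T1 : measurableType d1)
  (T2 : measurableType d2) (R : realType).
Variables (k : R.-pker T1 ~> T2) (phi : {mfun T0 >-> T1}).

Definition kpullback (x : T0) : {measure set T2 -> \bar R} := k (phi x).

Let measurable_kpullback U :
  measurable U -> measurable_fun [set: T0] (kpullback ^~ U).
Proof.
move=> mU.
exact: (measurableT_comp (measurable_kernel k U mU)).
Qed.

HB.instance Definition _ :=
  isKernel.Build _ _ _ _ _ kpullback measurable_kpullback.

Let kpullbackT x : kpullback x setT = 1.
Proof. exact: prob_kernel. Qed.

HB.instance Definition _ :=
  Kernel_isProbability.Build _ _ _ _ _ kpullback kpullbackT.

End kernel_pullback.

Section transition.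
Context dS dA dW (S : measurableType dS) (A : measurableType dA)
  (W : measurableType dW) (R : realType).
Variables (f : {mfun (S * A * W)%type >-> S}) (q : probability W R).

Definition next (x : S * A) (w : W) : S := f (x, w).

Let measurable_next x : measurable_fun [set: W] (next x).
Proof. by apply: measurableT_comp => //; exact: measurable_pair1. Qed.

HB.instance Definition _ x :=
  isMeasurableFun.Build _ _ _ _ (next x) (measurable_next x).

Definition transition (x : S * A) : {measure set S -> \bar R} :=
  distribution q (next x).

Let measurable_transition U :
  measurable U -> measurable_fun [set: S * A] (transition ^~ U).
Proof.
move=> mU; have mfU : measurable (f @^-1` U) by exact: measurable_funPTI.
have -> : transition ^~ U = (fun x => q (xsection (f @^-1` U) x)).
  by apply/funext => x; rewrite xsectionE.
exact: measurable_fun_xsection.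
Qed.

HB.instance Definition _ :=
  isKernel.Build _ _ _ _ _ transition measurable_transition.

Let transitionT x : transition x setT = 1.
Proof. exact: probability_setT. Qed.

HB.instance Definition _ :=
  Kernel_isProbability.Build _ _ _ _ _ transition transitionT.

End transition.

Section histories.
Context dS dA (S : measurableType dS) (A : measurableType dA).

(* [history t] is the space of (x_0, ..., x_t), (a_0, ..., a_{t-1}). *)
Definition history (t : nat) : Type := (t.+1.-tuple S * t.-tuple A)%type.

Definition current t (h : history t) : S := tnth h.1 ord_max.

Definition current_action t (ha : history t * A) : S * A :=
  (current ha.1, ha.2).

Definition init_history (x : S) : history 0 := ([tuple x], [tuple]).

Definition extend t (y : history t * A * S) : history t.+1 :=
  ([tuple of rcons y.1.1.1 y.2], [tuple of rcons y.1.1.2 y.1.2]).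

Lemma measurable_rcons d d' (T1 : measurableType d) (T2 : measurableType d') t
    (g : T1 -> t.-tuple T2) (e : T1 -> T2) :
  measurable_fun [set: T1] g -> measurable_fun [set: T1] e ->
  measurable_fun [set: T1] (fun y => [the t.+1.-tuple T2 of rcons (g y) (e y)]).
Proof.
move=> mg me; apply/measurable_fun_tnthP => i.
have [it|it] := ltnP i t.
  rewrite (_ : _ \o _ = fun y => tnth (g y) (Ordinal it)).
    exact: (measurableT_comp (measurable_tnth _)).
  apply/funext => y /=.
  by rewrite !(tnth_nth (e y))/= nth_rcons size_tuple it.
rewrite (_ : _ \o _ = e)//; apply/funext => y /=.
rewrite (tnth_nth (e y))/= nth_rcons size_tuple ltnNge it/=.
by case: ifP.
Qed.

Let measurable_current t : measurable_fun [set: history t] (@current t).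
Proof. exact: (measurableT_comp (measurable_tnth _)). Qed.

HB.instance Definition _ t :=
  isMeasurableFun.Build _ _ _ _ (@current t) (@measurable_current t).

Let measurable_current_action t :
  measurable_fun [set: history t * A] (@current_action t).
Proof.
apply/measurable_fun_pairP; split => //=.
  exact: (measurableT_comp (@measurable_current t)).
exact: measurable_snd.
Qed.

HB.instance Definition _ t := isMeasurableFun.Build _ _ _ _
  (@current_action t) (@measurable_current_action t).

Let measurable_init_history : measurable_fun [set: S] init_history.
Proof.
apply/measurable_fun_pairP; split => //=; apply/measurable_fun_tnthP => i.
  by rewrite (_ : _ \o _ = id)//; apply/funext => x; rewrite /= ord1.
by case: i.
Qed.

HB.instance Definition _ := isMeasurableFun.Build _ _ _ _
  init_history measurable_init_history.

Let measurable_extend t :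
  measurable_fun [set: history t * A * S] (@extend t).
Proof.
apply/measurable_fun_pairP; split; apply: measurable_rcons => //.
- by apply: measurableT_comp => //; exact: measurableT_comp.
- by apply: measurableT_comp => //; exact: measurableT_comp.
- exact: measurableT_comp.
Qed.

HB.instance Definition _ t := isMeasurableFun.Build _ _ _ _
  (@extend t) (@measurable_extend t).

End histories.

Section policies.
Context (T : nat) (R : realType) dS dA dW (S : measurableType dS)
  (A : measurableType dA) (W : measurableType dW).

Definition policy : Type := forall t : 'I_T, R.-pker history S A t ~> A.

Definition markov_policy (pi : policy) : Prop :=
  forall t : 'I_T, exists k : R.-pker S ~> A,
    forall (h : history S A t) (B : set A), measurable B ->
      pi t h B = k (current h) B.

Variables (f : {mfun (S * A * W)%type >-> S}) (p0 : probability S R)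
  (q : 'I_T -> probability W R).

(* The law of (x_0, ..., x_t), (a_0, ..., a_{t-1}) under [pi]. The noises enter
   through their laws [q] only; their mutual independence, and their
   independence from x_0, are encoded by drawing x_{t+1} from a kernel that
   depends on the past through (x_t, a_t) alone. *)
Fixpoint history_law (pi : policy) (t : nat) :
    (t <= T)%N -> probability (history S A t) R :=
  match t with
  | 0 => fun=> distribution p0 (@init_history _ _ S A)
  | u.+1 => fun uT =>
      distribution
        (semidirect
          (semidirect (history_law pi (ltnW uT)) (pi (Ordinal uT)))
          (kpullback (transition f (q (Ordinal uT)))
            (@current_action _ _ S A u)))
        (@extend _ _ S A u)
  end.

Definition trajectory_law (pi : policy) : probability (history S A T) R :=
  history_law pi (leqnn T).

Variables (g : 'I_T -> S * A -> R) (gT : S -> R).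

Definition stage_reward (t : 'I_T) (h : history S A T) : R :=
  g t (tnth h.1 (widen_ord (leqnSn T) t), tnth h.2 t).

Definition terminal_reward (h : history S A T) : R := gT (tnth h.1 ord_max).

Definition objective (pi : policy) : \bar R :=
  'E_(trajectory_law pi)
    [fun h => (\sum_(t < T) stage_reward t h + terminal_reward h)%R].

Definition objective_well_defined (pi : policy) : Prop :=
  let P := trajectory_law pi in
  \sum_(t < T) 'E_P[(stage_reward t)^\+%R] + 'E_P[terminal_reward^\+%R] < +oo \/
  \sum_(t < T) 'E_P[(stage_reward t)^\-%R] + 'E_P[terminal_reward^\-%R] < +oo.

End policies.

Section augmented_system.
Context dX dA dW (X : measurableType dX) (A : measurableType dA)
  (W : measurableType dW).
Variables (f : {mfun (X * A * W)%type >-> X}) (Xa : set X) (mXa : measurable Xa).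

Let measurable_alarm : measurable_fun [set: X] (fun x => x \in Xa).
Proof.
apply: (@measurable_fun_bool _ _ _ _ true); rewrite setTI.
rewrite (_ : _ @^-1` _ = Xa)//.
by apply/seteqP; split => x; [exact: set_mem|exact: mem_set].
Qed.

Definition flag_init (x : X) : X * bool := (x, x \in Xa).

Let measurable_flag_init : measurable_fun [set: X] flag_init.
Proof. by apply/measurable_fun_pairP; split; [exact: measurable_id|]. Qed.

(* Not instances: the measurability of [Xa] cannot be inferred. *)
Definition augmented_init : {mfun X >-> (X * bool)%type} :=
  HB.pack_for {mfun X >-> (X * bool)%type} flag_init
    (isMeasurableFun.Build _ _ _ _ flag_init measurable_flag_init).

(* the argument is ((x_t, phi_t), a_t, w_t) *)
Definition flag_dynamics (y : X * bool * A * W) : X * bool :=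
  let x' := f (y.1.1.1, y.1.2, y.2) in (x', (x' \in Xa) || y.1.1.2).

Let measurable_flag_dynamics :
  measurable_fun [set: X * bool * A * W] flag_dynamics.
Proof.
have m11 : measurable_fun [set: X * bool * A * W] (fun y => y.1.1).
  exact: (measurableT_comp measurable_fst measurable_fst).
have m111 : measurable_fun [set: X * bool * A * W] (fun y => y.1.1.1).
  exact: (measurableT_comp measurable_fst m11).
have m112 : measurable_fun [set: X * bool * A * W] (fun y => y.1.1.2).
  exact: (measurableT_comp measurable_snd m11).
have m12 : measurable_fun [set: X * bool * A * W] (fun y => y.1.2).
  exact: (measurableT_comp measurable_snd measurable_fst).
have mf : measurable_fun [set: X * bool * A * W]
    (fun y => f (y.1.1.1, y.1.2, y.2)).
  apply: measurableT_comp => //.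
  apply/measurable_fun_pairP; split; last exact: measurable_snd.
  by apply/measurable_fun_pairP.
apply/measurable_fun_pairP; split; first exact: mf.
exact: (measurable_or (measurableT_comp measurable_alarm mf) m112).
Qed.

Definition augmented_dynamics :
    {mfun (X * bool * A * W)%type >-> (X * bool)%type} :=
  HB.pack_for {mfun (X * bool * A * W)%type >-> (X * bool)%type} flag_dynamics
    (isMeasurableFun.Build _ _ _ _ flag_dynamics measurable_flag_dynamics).

End augmented_system.

(* Main.v *)
From HB Require Import structures.
Require Import Defs.
From mathcomp Require Import all_boot all_order all_algebra.
From mathcomp Require Import all_classical all_reals all_analysis.
From mathcomp Require Import measurable_realfun.
From mathcomp Require Import lra.

(* A history-dependent policy of the augmented system sees no more than one of
   the original system, because the flags are a function of the states: the
   map [augment] recomputes them, and transports the trajectory law of the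
   original system to that of the augmented one.  This gives (i) = (ii).

   For (ii) = (iii), the objective and the constraint depend only on the laws of
   the pairs (state, action) at each time and of the terminal state.  Replacing
   the action kernel at each time by the conditional law of the action given the
   current state keeps all of them.  Conditional laws on a Borel subset of R^m
   are obtained by transporting the existence of disintegrations along
   measurable retracts, from R^m to A and from the extended reals to R, together
   with iteration over the coordinates.  On the extended reals the conditional
   law at [s] is the image of the uniform law under the quantile function
   u |-> sup {q rational | u <= F q s}, where [F q] is a Radon-Nikodym density of
   nu (_ `*` ]q, +oo]). *)

Set Implicit Arguments.
Unset Strict Implicit.
Unset Printing Implicit Defensive.

Import Order.TTheory GRing.Theory Num.Theory.
Import numFieldNormedType.Exports.

Local Open Scope classical_set_scope.
Local Open Scope ring_scope.
Local Open Scope ereal_scope.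

(** * Kernels and semidirect products *)

Definition mfun_of d d' (T : measurableType d) (T' : measurableType d')
    (f : T -> T') (mf : measurable_fun setT f) : {mfun T >-> T'} :=
  HB.pack_for {mfun T >-> T'} f (isMeasurableFun.Build _ _ _ _ f mf).

Section kernel_image.
Context d1 d2 d3 (T1 : measurableType d1) (T2 : measurableType d2)
  (T3 : measurableType d3) (R : realType).
Variables (k : R.-pker T1 ~> T2) (psi : {mfun (T1 * T2)%type >-> T3}).

Definition fiber (x : T1) (y : T2) : T3 := psi (x, y).

Let measurable_fiber x : measurable_fun [set: T2] (fiber x).
Proof. by apply: measurableT_comp => //; exact: pair1_measurable. Qed.

HB.instance Definition _ x :=
  isMeasurableFun.Build _ _ _ _ (fiber x) (measurable_fiber x).

(** The law of [psi (x, y)] for [y] drawn from [k x]. Since [psi] also sees [x], this covers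
    recodings of a kernel and, from a constant kernel, randomization by an auxiliary uniform
    variable. *)
Definition kimage (x : T1) : set T3 -> \bar R := pushforward (k x) (fiber x).

Let kimage0 x : kimage x set0 = 0.
Proof. exact: measure0. Qed.

Let kimage_ge0 x U : 0 <= kimage x U.
Proof. exact: measure_ge0. Qed.

Let kimage_sigma_additive x : semi_sigma_additive (kimage x).
Proof. exact: measure_semi_sigma_additive. Qed.

HB.instance Definition _ x := isMeasure.Build _ _ _ (kimage x)
  (kimage0 x) (@kimage_ge0 x) (@kimage_sigma_additive x).

Definition mkimage : T1 -> {measure set T3 -> \bar R} := kimage.

Let measurable_kimage U :
  measurable U -> measurable_fun [set: T1] (mkimage ^~ U).
Proof.
move=> mU; have mfU : measurable (psi @^-1` U) by exact: measurable_funPTI.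
have -> : mkimage ^~ U = (fun x => k x (xsection (psi @^-1` U) x)).
  by apply/funext => x; rewrite xsectionE.
by apply: measurable_fun_xsection_finite_kernel; rewrite inE.
Qed.

HB.instance Definition _ :=
  isKernel.Build _ _ _ _ _ mkimage measurable_kimage.

Let kimageT x : mkimage x setT = 1.
Proof. exact: prob_kernel. Qed.

HB.instance Definition _ :=
  Kernel_isProbability.Build _ _ _ _ _ mkimage kimageT.

End kernel_image.

Lemma measurable_kernel_xsection d1 d2 (T1 : measurableType d1)
    (T2 : measurableType d2) (R : realType) (k : R.-pker T1 ~> T2)
    (C : set (T1 * T2)) :
  measurable C -> measurable_fun setT (fun x => k x (xsection C x)).
Proof.
by move=> mC; apply: measurable_fun_xsection_finite_kernel; rewrite inE.
Qed.

Lemma semidirect_rect d1 d2 (T1 : measurableType d1) (T2 : measurableType d2)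
    (R : realType) (mu : probability T1 R) (k : R.-pker T1 ~> T2)
    (A : set T1) (B : set T2) : measurable A -> measurable B ->
  semidirect mu k (A `*` B) = \int[mu]_(x in A) k x B.
Proof.
move=> mA mB; rewrite /semidirect [RHS]integral_mkcond.
apply: eq_integral => x _; rewrite /patch; case: ifPn => xA.
  by rewrite in_xsectionX.
by rewrite notin_xsectionX// measure0.
Qed.

(** Change of variables along [phi] in the base and along [psi] in the fibres. [psi] sees the whole
    pair, because the new second coordinate may depend on the old first one, as an alarm flag
    does. *)
Lemma semidirect_map d1 d2 d1' d2' (T1 : measurableType d1)
    (T2 : measurableType d2) (T1' : measurableType d1')
    (T2' : measurableType d2') (R : realType)
    (mu : probability T1 R) (k : R.-pker T1 ~> T2)
    (mu' : probability T1' R) (k' : R.-pker T1' ~> T2')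
    (phi : T1 -> T1') (psi : T1 * T2 -> T2') :
  measurable_fun setT phi -> measurable_fun setT psi ->
  (forall A, measurable A -> mu' A = mu (phi @^-1` A)) ->
  (forall x B, measurable B -> k' (phi x) B = k x [set y | B (psi (x, y))]) ->
  forall C, measurable C ->
    semidirect mu' k' C = semidirect mu k [set z | C (phi z.1, psi z)].
Proof.
move=> mphi mpsi mu'E k'E C mC; rewrite /semidirect.
rewrite (eq_measure_integral (pushforward mu phi)); last first.
  by move=> A mA _; exact: mu'E.
rewrite ge0_integral_pushforward//; last first.
  exact: measurable_kernel_xsection.
rewrite preimage_setT; apply: eq_integral => x _ /=.
rewrite k'E; last exact: measurable_xsection.
by congr (k x _); apply/seteqP; split => y; rewrite !xsectionE.
Qed.

Lemma semidirect_fst d1 d2 (T1 : measurableType d1) (T2 : measurableType d2)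
    (R : realType) (mu : probability T1 R) (k : R.-pker T1 ~> T2)
    (A : set T1) : measurable A -> semidirect mu k (fst @^-1` A) = mu A.
Proof.
move=> mA; have -> : fst @^-1` A = A `*` [set: T2].
  by apply/seteqP; split => x //= [].
rewrite semidirect_rect//; under eq_integral do rewrite prob_kernel.
by rewrite integral_cst// mul1e.
Qed.

Lemma eq_semidirect d1 d2 (T1 : measurableType d1) (T2 : measurableType d2)
    (R : realType) (mu mu' : probability T1 R) (k k' : R.-pker T1 ~> T2) :
  (forall A, measurable A -> mu A = mu' A) ->
  (forall x B, measurable B -> k x B = k' x B) ->
  forall C, measurable C -> semidirect mu k C = semidirect mu' k' C.
Proof.
move=> mumu' kk' C mC.
rewrite (@semidirect_map _ _ _ _ _ _ _ _ _ mu' k' mu k id snd)//.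
Qed.

(** Rectangles with second side in the pi-system [G] form a pi-system that generates the product
    sigma-algebra. [G setT] puts the cylinders over the first factor among them. *)
Lemma prod_measure_ext d1 d2 (T1 : measurableType d1) (T2 : measurableType d2)
    (R : realType) (G : set (set T2)) (P Q : probability (T1 * T2)%type R) :
  measurable = <<s G >> -> setI_closed G -> G setT ->
  (forall A B, measurable A -> G B -> P (A `*` B) = Q (A `*` B)) ->
  forall C, measurable C -> P C = Q C.
Proof.
move=> mG GI GT PQ C mC.
pose H : set (set (T1 * T2)) := [set A `*` B | A in measurable & B in G].
apply: (measure_unique H (fun=> setT)) => //.
- rewrite measurable_prod_measurableType eqEsubset; split.
    apply: smallest_sub; first exact: smallest_sigma_algebra.
    move=> _ [A mA] [B mB] <-.
    have -> : A `*` B = (A `*` setT) `&` (snd @^-1` B).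
      by apply/seteqP; split => x /= [] //; move=> [].
    apply: (@measurableI _ (g_sigma_algebraType H)).
      by apply: sub_sigma_algebra; exists A => //; exists setT.
    (* Cylinders over the second factor are handled through generators: taking preimages commutes
       with generating a sigma-algebra. *)
    have : preimage_set_system setT (snd : T1 * T2 -> T2) <<s G >> (snd @^-1` B).
      by exists B; rewrite ?setTI// -mG.
    rewrite -g_sigma_preimageE; apply: sub_sigma_algebra2 => _ [D GD <-].
    by exists setT => //; exists D => //; rewrite setTX setTI.
  apply: sub_sigma_algebra2 => _ [A mA] [B GB] <-; exists A => //; exists B => //.
  by rewrite mG; exact: sub_sigma_algebra.
- move=> _ _ [A mA] [B GB] <- [A' mA'] [B' GB'] <-; rewrite -setXI.
  by exists (A `&` A'); [exact: measurableI|exists (B `&` B') => //; exact: GI].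
- by move=> _; exists setT => //; exists setT => //; rewrite setXTT.
- by rewrite bigcup_const.
- by move=> _ [A mA] [B GB] <-; exact: PQ.
- by move=> _; rewrite /= probability_setT ltry.
Qed.

Lemma integral_semidirect d1 d2 (T1 : measurableType d1)
    (T2 : measurableType d2) (R : realType) (mu : probability T1 R)
    (k : R.-pker T1 ~> T2) (F : T1 * T2 -> \bar R) :
  (forall z, 0 <= F z) -> measurable_fun setT F ->
  \int[semidirect mu k]_z F z = \int[mu]_x \int[k x]_y F (x, y).
Proof.
move=> F0 mF.
(* A kernel composition that starts from the one-point space: [M] draws [x] from [mu], and [K] draws
   [y] while keeping [x]. *)
pose K : R.-pker (unit * T1)%type ~> (T1 * T2)%type :=
  kpullback (mkimage k (mfun_of (measurable_id (D := setT))))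
    (mfun_of (@measurable_snd _ _ unit T1)).
pose M : R.-pker unit ~> T1 :=
  kprobability (measurable_cst (mu : pprobability T1 R)).
rewrite (eq_measure_integral (kcomp M K tt)); last first.
  move=> C mC _; apply: eq_integral => x _ /=.
  rewrite /kpullback /= /mkimage /kimage /pushforward.
  by rewrite xsectionE.
rewrite integral_kcomp//; apply: eq_integral => x _ /=.
by rewrite ge0_integral_pushforward.
Qed.

Section kernel_sequence.
Context d1 d2 d3 (T1 : measurableType d1) (T2 : measurableType d2)
  (T3 : measurableType d3) (R : realType).
Variables (k : R.-pker T1 ~> T2) (l : R.-pker (T1 * T2)%type ~> T3).

Let reassoc (z : T1 * T2 * T3) : T2 * T3 := (z.1.2, z.2).

Let measurable_reassoc : measurable_fun setT reassoc.
Proof.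
apply/measurable_fun_pairP; split; last exact: measurable_snd.
exact: (measurableT_comp measurable_snd measurable_fst).
Qed.

(** From [x], the law of a pair: its first component is drawn from [k x], and its second from [l]
    given [x] and that component. *)
Definition kseq : T1 -> {measure set (T2 * T3) -> \bar R} :=
  mkcomp k (mkimage l (mfun_of measurable_reassoc)).

HB.instance Definition _ := Kernel.on kseq.

Let kseqT x : kseq x setT = 1.
Proof.
rewrite /kseq /= /kcomp.
under eq_integral do rewrite prob_kernel.
by rewrite integral_cst// mul1e; exact: prob_kernel.
Qed.

HB.instance Definition _ := Kernel_isProbability.Build _ _ _ _ _ kseq kseqT.

End kernel_sequence.

(** * Disintegration *)

(** Existence of regular conditional laws on [B] given a variable in an arbitrary measurable space
    [S]. The marginal [mu] is a separate argument so that it may be given in any form, such as a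
    semidirect product. *)
Definition disintegrable d (B : measurableType d) (R : realType) : Prop :=
  forall d1 (S : measurableType d1) (mu : probability S R)
    (nu : probability (S * B)%type R),
  (forall A, measurable A -> nu (fst @^-1` A) = mu A) ->
  exists k : R.-pker S ~> B,
    forall C, measurable C -> nu C = semidirect mu k C.

(** Push [nu] forward by [i], disintegrate there, and take the image of the kernel under [r]. Since
    [r] is defined everywhere, the kernel on [B'] may charge points outside the image of [i]. *)
Lemma disintegrable_retract d d' (B : measurableType d)
    (B' : measurableType d') (R : realType) (i : B -> B') (r : B' -> B) :
  measurable_fun setT i -> measurable_fun setT r -> cancel i r ->
  disintegrable B' R -> disintegrable B R.
Proof.
move=> mi mr ir dB' d1 S mu nu nu1.
have mi' : measurable_fun setT (fun z : S * B => (z.1, i z.2)).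
  apply/measurable_fun_pairP; split; first exact: measurable_fst.
  exact: (measurableT_comp mi measurable_snd).
have mr' : measurable_fun setT (fun z : S * B' => r z.2).
  exact: (measurableT_comp mr measurable_snd).
have mr2 : measurable_fun setT (fun z : S * B' => (z.1, r z.2)).
  by apply/measurable_fun_pairP; split => //; exact: measurable_fst.
have [|k' k'E] := dB' _ S mu (distribution nu (mfun_of mi')).
  by move=> A mA; exact: nu1.
exists (mkimage k' (mfun_of mr')) => C mC.
rewrite (@semidirect_map _ _ _ _ _ _ _ _ _ mu k' _ _ id (fun z => r z.2))//.
rewrite -k'E /=; last first.
  by rewrite -[X in measurable X]setTI; exact: mr2.
rewrite /distribution /pushforward /=; congr (nu _).
by apply/seteqP; split => -[s b] /=; rewrite ir.
Qed.

(** Chain rule: condition the first component on [S], then the second on [S] and the first. The base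
    space of the second disintegration is [S * B]. *)
Lemma disintegrable_prod d d' (B : measurableType d)
    (B' : measurableType d') (R : realType) :
  disintegrable B R -> disintegrable B' R -> disintegrable (B * B')%type R.
Proof.
move=> dB dB' d1 S mu nu nu1.
have m1 : measurable_fun setT (fun z : S * (B * B') => (z.1, z.2.1)).
  apply/measurable_fun_pairP; split; first exact: measurable_fst.
  exact: (measurableT_comp measurable_fst measurable_snd).
have m2 : measurable_fun setT (fun z : S * (B * B') => (z.1, z.2.1, z.2.2)).
  apply/measurable_fun_pairP; split; first exact: m1.
  exact: (measurableT_comp measurable_snd measurable_snd).
have m3 : measurable_fun setT (fun z : S * B * B' => (z.1.1, (z.1.2, z.2))).
  have m11 : measurable_fun setT (fun z : S * B * B' => z.1.1).
    exact: (measurableT_comp measurable_fst measurable_fst).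
  have m12 : measurable_fun setT (fun z : S * B * B' => z.1.2).
    exact: (measurableT_comp measurable_snd measurable_fst).
  apply/measurable_fun_pairP; split; first exact: m11.
  apply/measurable_fun_pairP; split; first exact: m12.
  exact: measurable_snd.
have [|k kE] := dB _ S mu (distribution nu (mfun_of m1)).
  by move=> A mA; exact: nu1.
have [|l lE] := dB' _ _ (semidirect mu k) (distribution nu (mfun_of m2)).
  by move=> A mA; exact: kE.
exists (kseq k l) => C mC.
pose D := (fun z : S * B * B' => (z.1.1, (z.1.2, z.2))) @^-1` C.
have mD : measurable D by rewrite -[D]setTI; exact: m3.
have -> : nu C = distribution nu (mfun_of m2) D.
  rewrite /distribution /pushforward /D /=; congr (nu _).
  by apply/seteqP; split => -[s [b b']].
rewrite lE// [LHS]integral_semidirect//; last exact: measurable_kernel_xsection.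
Qed.

Section slice_measure.
Context d1 d2 (T1 : measurableType d1) (T2 : measurableType d2) (R : realType).
Variables (nu : probability (T1 * T2)%type R) (V : set T2) (mV : measurable V).

(** The measurability proof is part of the term so that the measure instances can refer to it. *)
Definition slice of measurable V : set T1 -> \bar R :=
  fun A => nu (A `*` V).

Let slice0 : slice mV set0 = 0.
Proof. by rewrite /slice set0X measure0. Qed.

Let slice_ge0 A : 0 <= slice mV A.
Proof. exact: measure_ge0. Qed.

Let slice_sigma_additive : semi_sigma_additive (slice mV).
Proof.
move=> F mF tF mUF; rewrite /slice setX_bigcupl.
apply: measure_semi_sigma_additive.
- by move=> i; exact: measurableX.
- apply/trivIsetP => i j _ _ ij; rewrite -setXI.
  by move/trivIsetP : tF => ->//; rewrite set0X.
- by rewrite -setX_bigcupl; exact: measurableX.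
Qed.

HB.instance Definition _ := isMeasure.Build _ _ _ (slice mV)
  slice0 slice_ge0 slice_sigma_additive.

Let slice_fin : fin_num_fun (slice mV).
Proof. by move=> A mA; apply: fin_num_measure; exact: measurableX. Qed.

HB.instance Definition _ := @Measure_isFinite.Build _ _ _ (slice mV) slice_fin.

End slice_measure.

Lemma ae_le_of_integral_le d (T : measurableType d) (R : realType)
    (mu : probability T R) (f g : T -> \bar R) :
  (forall x, 0 <= f x) -> (forall x, 0 <= g x) ->
  measurable_fun setT f -> mu.-integrable setT g ->
  (forall A, measurable A -> \int[mu]_(x in A) f x <= \int[mu]_(x in A) g x) ->
  {ae mu, forall x, f x <= g x}.
Proof.
move=> f0 g0 mf ig fg; have mg := measurable_int _ ig.
(* [h] has the same integrals as [g], hence [h = g] almost everywhere. *)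
pose h x := maxe (f x) (g x).
have mh : measurable_fun setT h by exact: measurable_maxe.
have h0 x : 0 <= h x by rewrite le_max f0.
have mN : measurable [set x | f x <= g x].
  by rewrite -[X in measurable X]setTI; exact: measurable_lee.
have hg : ae_eq mu setT g h.
  apply: integral_ae_eq => // A _ mA; apply/eqP; rewrite eq_le; apply/andP; split.
    apply: ge0_le_integral => //; [exact: measurable_funTS..|].
    by move=> x _; rewrite le_max lexx orbT.
  (* [h] equals [g] on the first piece and [f] on the second, where the hypothesis on integrals
     applies. *)
  have AE : A = (A `&` [set x | f x <= g x]) `|` (A `\` [set x | f x <= g x]).
    by rewrite setUIDK.
  have mA1 : measurable (A `&` [set x | f x <= g x]) by exact: measurableI.
  have mA2 : measurable (A `\` [set x | f x <= g x]) by exact: measurableD.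
  have dA : [disjoint A `&` [set x | f x <= g x] & A `\` [set x | f x <= g x]].
    by apply/disj_setPS => x [[_ ?] [_]].
  rewrite AE !ge0_integral_setU//=; try exact: measurable_funTS.
  rewrite leeD//.
    apply: ge0_le_integral => //; [exact: measurable_funTS..|].
    by move=> x [_ /= fgx]; rewrite /h max_r.
  apply: le_trans (fg _ mA2).
  apply: ge0_le_integral => //; [exact: measurable_funTS..|].
  move=> x [_ /= /negP]; rewrite -ltNge => fgx.
  by rewrite /h max_l// ltW.
by apply: filterS hg => x /= /(_ I) ->; rewrite /h le_max lexx.
Qed.

(** Comparing a uniform variable with a threshold realizes an event of prescribed probability. The
    threshold is an extended real because the densities are. *)
Lemma uniform_prob_le (R : realType) (x : \bar R) : 0 <= x -> x <= 1 ->
  uniform_prob (@ltr01 R) [set u | u%:E <= x] = x.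
Proof.
case: x => [r| |]// r0 r1; rewrite !lee_fin in r0 r1.
rewrite /uniform_prob integral_uniform_pdf.
have -> : [set u : R | u%:E <= r%:E] `&` `[0%R, 1%R]%classic = `[0%R, r]%classic.
  apply/seteqP; split => u /=; rewrite !in_itv/= lee_fin.
    by move=> [-> /andP[->]].
  by move=> /andP[u0 ur]; rewrite ur u0 (le_trans ur r1).
rewrite (eq_integral (cst 1)); last first.
  move=> u; rewrite inE /= in_itv/= /uniform_pdf => /andP[u0 ur].
  by rewrite u0 (le_trans ur r1) subr0 invr1.
rewrite integral_cst//= mul1e lebesgue_measure_itv/= lte_fin.
by case: ltgtP r0 => // [_ _|<- _]; rewrite ?oppr0 ?adde0 ?sube0.
Qed.

(** [F] comes from the Radon-Nikodym density of the slice of [nu] at [V], which [mu] dominates. That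
    density is at most 1 only almost everywhere, so it is truncated at 1 to make the bound hold at
    every point. *)
Lemma conditional_probability d1 d2 (T1 : measurableType d1)
    (T2 : measurableType d2) (R : realType) (mu : probability T1 R)
    (nu : probability (T1 * T2)%type R) (V : set T2) : measurable V ->
  (forall A, measurable A -> nu (fst @^-1` A) = mu A) ->
  exists F : T1 -> \bar R, [/\ measurable_fun setT F,
    forall x, 0 <= F x <= 1 &
    forall A, measurable A -> nu (A `*` V) = \int[mu]_(x in A) F x].
Proof.
move=> mV nu1.
have numu A : measurable A -> slice nu mV A <= mu A.
  move=> mA; rewrite /slice -nu1//; apply: le_measure; rewrite ?inE.
  - exact: measurableX.
  - by rewrite -[X in measurable X]setTI; exact: measurable_fst.
  - by move=> x [].
have [|f [f0 fi fE]] := @radon_nikodym_finite _ _ R mu (slice nu mV).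
  apply/null_content_dominatesP => A mA muA0.
  by apply/eqP; rewrite eq_le measure_ge0 andbT -muA0; exact: numu.
have mf := measurable_int _ fi.
have f1 : {ae mu, forall x, f x <= 1}.
  apply: (@ae_le_of_integral_le _ _ _ mu f (cst 1)) => //.
  - apply/integrableP; split => //=.
    under eq_integral do rewrite /= normr1.
    rewrite integral_cst// mul1e.
    by rewrite (le_lt_trans (probability_le1 mu measurableT)) ?ltry.
  - by move=> A mA; rewrite -fE// integral_cst// mul1e; exact: numu.
exists (fun x => mine (f x) 1); split.
- exact: measurable_mine.
- by move=> x; rewrite le_min f0 lee01/= ge_min lexx orbT.
- move=> A mA; rewrite -[LHS]/(slice nu mV A) fE//; apply: ae_eq_integral => //.
  + exact: measurable_funTS.
  + by apply: measurable_funTS; exact: measurable_mine.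
  + by apply: filterS f1 => x fx1 _; rewrite min_l.
Qed.

Section constant_kernel.
Context d1 d2 (T1 : measurableType d1) (T2 : measurableType d2) (R : realType).

Definition kconst (P : probability T2 R) : R.-pker T1 ~> T2 :=
  kprobability (measurable_cst (P : pprobability T2 R)).

End constant_kernel.
Arguments kconst {d1 d2} T1 {T2 R} P.

(** With [Q (x, u)] the supremum of the rationals [rn n] such that [u <= F (rn n) x], let [k x] be
    the law of [Q (x, u)] for [u] uniform. The mass that [k x] gives to the ray above [r] is at
    least [F (rn n) x] for each [rn n > r], and almost everywhere at most [F r x]. Continuity of
    [nu] along increasing rays closes the gap. *)
Lemma disintegrable_ereal (R : realType) : disintegrable (\bar R) R.
Proof.
move=> d1 S mu nu nu1.
have mray r : measurable (`]r%:E, +oo[%classic : set (\bar R)).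
  exact: emeasurable_itv.
have /choice[F FP] : forall r : R, exists F : S -> \bar R,
    [/\ measurable_fun setT F, forall x, 0 <= F x <= 1 &
    forall A, measurable A ->
      nu (A `*` `]r%:E, +oo[%classic) = \int[mu]_(x in A) F x].
  by move=> r; exact: conditional_probability.
have mF r : measurable_fun setT (F r) by have [] := FP r.
have F0 r x : 0 <= F r x by have [_ /(_ x)/andP[]] := FP r.
have F1 r x : F r x <= 1 by have [_ /(_ x)/andP[]] := FP r.
have FE r A : measurable A ->
    nu (A `*` `]r%:E, +oo[%classic) = \int[mu]_(x in A) F r x.
  by have [_ _] := FP r; exact.
(* An enumeration of the rationals; an integer that codes no rational is read as 0. *)
pose rn (n : nat) : R := ratr (odflt 0%R (unpickle n : option rat)).
have rnE (q : rat) : exists n, rn n = ratr q.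
  by exists (pickle q); rewrite /rn pickleK.
(* The value [-oo] is neutral for the supremum, so indices that fail the test do not count. If all
   fail, [Q] is [-oo], a legitimate value here. *)
pose J (z : S * measurableTypeR R) (n : nat) : \bar R :=
  if z.2%:E <= F (rn n) z.1 then (rn n)%:E else -oo.
pose Q (z : S * measurableTypeR R) : \bar R := esups (J z) 0%N.
have mcut n : measurable_fun setT
    (fun z : S * measurableTypeR R => z.2%:E <= F (rn n) z.1).
  apply: measurable_fun_lee.
    apply/measurable_EFinP; exact: measurable_snd.
  exact: (measurableT_comp (mF (rn n)) measurable_fst).
have mJ n : measurable_fun setT (J ^~ n).
  by apply: measurable_fun_ifT => //; exact: measurable_cst.
have mQ : measurable_fun setT Q by exact: (measurable_fun_esups mJ 0%N).
have QP r z : (r%:E < Q z) <-> exists2 n, (r < rn n)%R & z.2%:E <= F (rn n) z.1.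
  have := congr1 (fun A => A z) (esups_preimage r%:E (fun n z => J z n) 0%N).
  rewrite /= in_itv/= andbT -/(Q z) => ->; split.
    move=> [n _] /=; rewrite in_itv/= andbT /J; case: ifP => // zF rrn.
    by exists n => //; rewrite -lte_fin.
  by move=> [n rrn zF]; exists n => //=; rewrite in_itv/= andbT /J zF lte_fin.
pose U : probability (measurableTypeR R) R := uniform_prob (@ltr01 R).
pose k : R.-pker S ~> \bar R :=
  mkimage (kconst S U) (mfun_of mQ).
have kE r x : k x `]r%:E, +oo[%classic =
    U [set u | r%:E < Q (x, u)].
  rewrite /k /= /mkimage /kimage /pushforward /=; congr (U _).
  by apply/seteqP; split => u /=; rewrite in_itv/= andbT.
have mlevel n x : measurable [set u : R | u%:E <= F (rn n) x].
  rewrite -[X in measurable X]setTI; exact: measurable_lee.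
have mQx r x : measurable [set u : R | r%:E < Q (x, u)].
  have -> : [set u : R | r%:E < Q (x, u)] =
      \bigcup_(n in [set n | (r < rn n)%R]) [set u | u%:E <= F (rn n) x].
    apply/seteqP; split => u.
      by move=> /= /QP[n rn_ uF]; exists n.
    by move=> [n rn_ uF] /=; apply/QP; exists n.
  by apply: bigcup_measurable => n _; exact: mlevel.
have k_ge r n x : (r < rn n)%R -> F (rn n) x <= k x `]r%:E, +oo[%classic.
  move=> rrn; rewrite kE -(@uniform_prob_le R (F (rn n) x))//.
  apply: le_measure; rewrite ?inE; [exact: mlevel|exact: mQx|].
  by move=> u uF /=; apply/QP; exists n.
have k_le r : {ae mu, forall x, k x `]r%:E, +oo[%classic <= F r x}.
  (* Each density is fixed only up to a null set, so monotonicity in the level holds almost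
     everywhere. Comparing [r] with the countably many [rn n] costs a single null set. *)
  have : {ae mu, forall x, forall n, (r < rn n)%R -> F (rn n) x <= F r x}.
    apply: ae_foralln => n.
    have [rrn|rnr] := ltP r (rn n); last by apply: aeW => x.
    have : {ae mu, forall x, F (rn n) x <= F r x}.
      apply: ae_le_of_integral_le => //.
      - apply/integrableP; split => //.
        apply: (@le_lt_trans _ _ (\int[mu]_x cst 1 x)).
          apply: ge0_le_integral => //.
            exact: measurableT_comp.
          by move=> x _; rewrite gee0_abs.
        rewrite integral_cst// mul1e.
        by rewrite (le_lt_trans (probability_le1 mu measurableT)) ?ltry.
      - move=> A mA; rewrite -!FE//; apply: le_measure; rewrite ?inE.
        + exact: measurableX.
        + exact: measurableX.
        + apply: setSX => // y /=; rewrite !in_itv/= !andbT; apply: lt_trans.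
          by rewrite lte_fin.
    by apply: filterS => x + _.
  apply: filterS => x Fx; rewrite kE -[leRHS](@uniform_prob_le R)//.
  apply: le_measure; rewrite ?inE; first exact: mQx.
    by rewrite -[X in measurable X]setTI; exact: measurable_lee.
  by move=> u /= /QP[n rrn /= uF]; apply: le_trans uF _; exact: Fx.
have mk r : measurable_fun setT (fun x => k x `]r%:E, +oo[%classic).
  exact: measurable_kernel.
exists k.
(* The open upper rays generate the Borel sets of the extended reals and are closed under
   intersection. The whole space is added because it contains [-oo] and so is not such a ray. *)
pose G := [set A : set (\bar R) |
  A = setT \/ exists r, A = `]r%:E, +oo[%classic].
apply: (@prod_measure_ext _ _ _ _ _ G).
- rewrite [LHS](ErealGenOInfty.measurableE R) eqEsubset; split.
    by apply: sub_sigma_algebra2 => A [r ->]; right; exists r.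
  apply: smallest_sub; first exact: smallest_sigma_algebra.
  move=> _ [->|[r ->]].
    have [G0 GC _] := smallest_sigma_algebra setT (@ErealGenOInfty.G R).
    by rewrite -(setD0 setT); exact: GC.
  by apply: sub_sigma_algebra; exists r.
- move=> A B [->|[r ->]] [->|[s ->]].
  + by left; rewrite setTI.
  + by right; exists s; rewrite setTI.
  + by right; exists r; rewrite setIT.
  + right; exists (Num.max r s); apply/seteqP; split => x /=.
      by rewrite !in_itv/= !andbT EFin_max gt_max => -[-> ->].
    by rewrite !in_itv/= !andbT EFin_max gt_max => /andP.
- by left.
- move=> A B mA [->|[r ->]].
    have -> : A `*` [set: \bar R] = fst @^-1` A.
      by apply/seteqP; split => x //= [].
    by rewrite nu1//; apply/esym; exact: semidirect_fst.
  transitivity (\int[mu]_(x in A) k x `]r%:E, +oo[%classic); last first.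
    by apply/esym; exact: semidirect_rect.
  apply/eqP; rewrite eq_le; apply/andP; split; last first.
    rewrite FE//; apply: ae_ge0_le_integral => //.
    - by apply: measurable_funTS; exact: mk.
    - exact: measurable_funTS.
    - by apply: filterS (k_le r) => x + _.
  (* For the other inequality, the ray above [r] is exhausted by the rays above [r + 1 / (i + 1)]. A
     rational strictly between these two levels gives a density [F (rn n)] whose integral over [A]
     lies between [nu (V i)] and the integral of [k]. *)
  pose V i : set (S * \bar R) := A `*` `](r + i.+1%:R^-1)%:E, +oo[%classic.
  have mV i : measurable (V i) by exact: measurableX.
  have VE : \bigcup_i V i = A `*` `]r%:E, +oo[%classic.
    apply/seteqP; split => -[x y].
      move=> [i _ [/= Ax]]; rewrite !in_itv/= !andbT => ry; split => //=.
      by apply: lt_trans ry; rewrite lte_fin ltrDl invr_gt0.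
    move=> [/= Ax]; rewrite in_itv/= andbT => ry.
    suff [i riy] : exists i : nat, (r + i.+1%:R^-1)%:E < y.
      by exists i => //; split => //=; rewrite in_itv/= andbT.
    case: y ry => [y| |] //; last by exists 0%N; rewrite ltry.
    rewrite lte_fin => ry.
    have := @ltr_add_invr R r y ry; move=> [i ri]; exists i.
    by rewrite lte_fin.
  have ndV : nondecreasing_seq V.
    move=> i j ij; apply/subsetPset; apply: setSX => // y /=.
    rewrite !in_itv/= !andbT; apply: le_lt_trans.
    by rewrite lee_fin lerD2l lef_pV2 ?posrE// ler_nat.
  have cV := @nondecreasing_cvg_mu _ _ _ nu V mV (bigcupT_measurable V mV) ndV.
  rewrite -VE; have /cvg_lim <- // := cV.
  apply: lime_le; first by apply/cvg_ex; eexists; exact: cV.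
  apply: nearW => i /=.
  have [q] : exists q : rat, (ratr q : R) \in `]r, (r + i.+1%:R^-1)%R[.
    by apply: rat_in_itvoo; rewrite ltrDl invr_gt0.
  rewrite in_itv/= => /andP[]; have [n <-] := rnE q => rrn rnr.
  apply: (@le_trans _ _ (\int[mu]_(x in A) F (rn n) x)).
    rewrite -FE//; apply: le_measure; rewrite ?inE//.
      exact: measurableX.
    apply: setSX => // y /=; rewrite !in_itv/= !andbT; apply: lt_trans.
    by rewrite lte_fin.
  apply: ge0_le_integral => //.
  - exact: measurable_funTS.
  - by apply: measurable_funTS; exact: mk.
  - by move=> x _; exact: k_ge.
Qed.

(** The retraction [fine] sends both infinities to 0. *)
Lemma disintegrable_real (R : realType) : disintegrable (measurableTypeR R) R.
Proof.
apply: (@disintegrable_retract _ _ (measurableTypeR R) (\bar R) R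
  EFin fine) => //.
exact: disintegrable_ereal.
Qed.

Lemma disintegrable_tuple d (B : measurableType d) (R : realType) m :
  disintegrable B R -> disintegrable (m.-tuple B) R.
Proof.
move=> dB; elim: m => [|m IH].
  (* The one-point space of empty tuples is a retract of [B], through its distinguished point. *)
  apply: (@disintegrable_retract _ _ _ _ R (fun=> point) (fun=> [tuple]) _ _ _ dB).
  - exact: measurable_cst.
  - exact: measurable_cst.
  - by move=> t; apply/val_inj; rewrite /= (tuple0 t).
apply: (@disintegrable_retract _ _ _ (B * m.-tuple B)%type R
  (fun t : m.+1.-tuple B => (thead t, [tuple of behead t]))
  (fun z => [tuple of z.1 :: z.2])); last exact: disintegrable_prod.
- apply/measurable_fun_pairP; split; first exact: measurable_tnth.
  apply/measurable_fun_tnthP => i.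
  rewrite (_ : _ \o _ = fun t : m.+1.-tuple B => tnth t (lift ord0 i)).
    exact: measurable_tnth.
  apply/funext => t; rewrite /= tnth_behead; congr (tnth _ _).
  by apply/val_inj; rewrite /= inordK ?ltnS ?ltn_ord.
- apply/measurable_fun_tnthP => i; case: (unliftP ord0 i) => [j ->|->].
    rewrite (_ : _ \o _ = fun z : B * m.-tuple B => tnth z.2 j).
      exact: (measurableT_comp (measurable_tnth j) measurable_snd).
    by apply/funext => z; rewrite /= tnthS.
  exact: measurable_fst.
- by move=> t /=; rewrite [RHS]tuple_eta.
Qed.

(** * Row vectors as tuples of real coordinates *)

Section borel_rV_tuple.
Context (R : realType) (m : nat).

Definition tuple_of_rV (v : borel_rV R m) : m.-tuple (measurableTypeR R) :=
  [tuple (v : 'rV[R]_m) ord0 j | j < m].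

Definition rV_of_tuple (t : m.-tuple (measurableTypeR R)) : borel_rV R m :=
  (\row_j tnth t j : 'rV[R]_m).

Lemma tuple_of_rVK : cancel tuple_of_rV rV_of_tuple.
Proof.
move=> v; apply/rowP => j; rewrite mxE.
by rewrite tnth_mktuple.
Qed.

Lemma measurable_tuple_of_rV : measurable_fun setT tuple_of_rV.
Proof.
apply/measurable_fun_tnthP => j.
rewrite (_ : _ \o _ = fun v : borel_rV R m => (v : 'rV[R]_m) ord0 j); last first.
  by apply/funext => v; rewrite /= tnth_mktuple.
apply: (measurability _ (RGenOpens.measurableE R)) => _ [_ [a [b ->]] <-].
rewrite setTI; apply: sub_sigma_algebra.
apply: open_comp; last exact: interval_open.
by move=> v _; exact: coord_continuous.
Qed.

(** Balls for the max norm, written by coordinates so that their preimages under [rV_of_tuple] are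
    finite intersections. *)
Let box (d : 'rV[R]_m) (k : nat) : set 'rV[R]_m :=
  [set v | forall j, `|d ord0 j - v ord0 j| < k.+1%:R^-1]%R.

(** Rational centres and radii [1 / (k + 1)] make the union countable, so preimages of open sets are
    measurable as soon as those of boxes are. *)
Let open_boxes (U : set 'rV[R]_m) : open U ->
  U = \bigcup_(i in [set i : 'rV[rat]_m * nat |
        box (map_mx ratr i.1) i.2 `<=` U]) box (map_mx ratr i.1) i.2.
Proof.
move=> oU; apply/seteqP; split; last by move=> v [i]; exact.
move=> v Uv; have := open_nbhs_nbhs (conj oU Uv).
move=> /nbhs_ballP[e /= e0 eU].
(* Half of [e], because the triangle inequality goes from [v] to [w] through the rational centre,
   each leg being shorter than the radius. *)
have [k ke] : exists k : nat, (k.+1%:R^-1 < e / 2 :> R)%R.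
  have [|k] := @ltr_add_invr R 0%R (e / 2)%R; first by rewrite divr_gt0.
  by rewrite add0r; exists k.
have k0 : (0 < k.+1%:R^-1 :> R)%R by rewrite invr_gt0.
have /choice[d dP] : forall j, exists q : rat,
    (`|ratr q - v ord0 j| < k.+1%:R^-1 :> R)%R.
  move=> j; have [q] : exists q : rat,
      (ratr q : R) \in `]v ord0 j, (v ord0 j + k.+1%:R^-1)%R[.
    by apply: rat_in_itvoo; rewrite ltrDl.
  rewrite in_itv/= => /andP[q1 q2]; exists q.
  by rewrite gtr0_norm ?subr_gt0// ltrBlDl.
exists (\row_j d j, k) => /=; last by move=> j; rewrite !mxE.
move=> w wb; apply: eU; split => // i j.
rewrite /ball/= (ord1 i).
rewrite -(subrKA (ratr (d j))) (le_lt_trans (ler_normD _ _))//.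
rewrite (splitr e) ltrD//.
  by rewrite distrC (lt_trans (dP j)).
by have := wb j; rewrite !mxE => /lt_trans; exact.
Qed.

Lemma measurable_rV_of_tuple : measurable_fun setT rV_of_tuple.
Proof.
apply: (@measurability _ _ _ (borel_rV R m) _ _ (@open 'rV[R]_m)) => //.
move=> _ [U oU <-]; rewrite setTI (open_boxes oU) preimage_bigcup.
rewrite bigcup_mkcond; apply: countable_bigcupT_measurable => [|[d k]].
  exact: countableP.
case: ifP => // _ /=.
rewrite (_ : _ @^-1` _ = \bigcap_(j in [set: 'I_m])
    ((fun t => tnth t j) @^-1`
      [set x : R | `|ratr (d ord0 j) - x| < k.+1%:R^-1]%R)); last first.
  apply/seteqP; split => t /= tb j.
    by move=> _; have := tb j; rewrite !mxE.
  by have := tb j I; rewrite !mxE.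
apply: fin_bigcap_measurable => // j _.
rewrite -[X in measurable X]setTI; apply: measurable_tnth => //.
rewrite (_ : [set x : R | _] = ball (ratr (d ord0 j) : R) (k.+1%:R^-1)%R) //.
exact: measurable_ball.
Qed.

End borel_rV_tuple.

(** [A] is a retract of the space of row vectors, and the latter of a power of the real line.
    Measurability of [A] makes the first retraction measurable. *)
Lemma disintegrable_borel_sub (R : realType) m (A : set (borel_rV R m))
    (A0 : A !=set0) : measurable A -> disintegrable (borel_sub A0) R.
Proof.
move=> mA.
have mval : measurable_fun setT (val : borel_sub A0 -> borel_rV R m).
  by move=> _ Y mY; exists Y.
pose r (v : borel_rV R m) : borel_sub A0 := insubd (point : pointed_sub A0) v.
have mr : measurable_fun setT r.
  move=> _ _ [Y mY <-]; rewrite !setTI.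
  (* Points outside [A] all go to the default point, so the complement of [A] is added to the
     preimage when that point lies in [Y] and left out otherwise. *)
  have [pY|pY] := pselect (Y (val (point : pointed_sub A0))).
    have -> : r @^-1` (val @^-1` Y) = (A `&` Y) `|` ~` A.
      apply/seteqP; split => v; rewrite /= /r val_insubd; case: ifPn => vA.
      + by left; split => //; exact: set_mem.
      + by move=> _; right => /mem_set; exact/negP.
      + by move=> [[]|] //; have := set_mem vA.
      + by [].
    by apply: measurableU; [exact: measurableI|exact: measurableC].
  have -> : r @^-1` (val @^-1` Y) = A `&` Y.
    apply/seteqP; split => v; rewrite /= /r val_insubd; case: ifPn => vA //.
    + by split => //; exact: set_mem.
    + by case.
    + by move=> [/mem_set]; rewrite (negbTE vA).
  exact: measurableI.
have rK : cancel (val : borel_sub A0 -> borel_rV R m) r.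
  by move=> a; exact: valKd.
apply: (disintegrable_retract mval mr rK).
apply: (disintegrable_retract (@measurable_tuple_of_rV R m)
  (@measurable_rV_of_tuple R m) (@tuple_of_rVK R m)).
exact/disintegrable_tuple/disintegrable_real.
Qed.

(** * Markov policies with prescribed marginals *)

Lemma tnth_rcons_widen n (B : Type) (t : n.-tuple B) (b : B) (i : 'I_n) :
  tnth [tuple of rcons t b] (widen_ord (leqnSn n) i) = tnth t i.
Proof. by rewrite !(tnth_nth b) /= nth_rcons size_tuple ltn_ord. Qed.

Lemma tnth_rcons_last n (B : Type) (t : n.-tuple B) (b : B) :
  tnth [tuple of rcons t b] ord_max = b.
Proof. by rewrite (tnth_nth b) /= nth_rcons size_tuple ltnn eqxx. Qed.

Definition state_action dS dA (S : measurableType dS) (A : measurableType dA)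
    u (i : 'I_u) (h : history S A u) : S * A :=
  (tnth h.1 (widen_ord (leqnSn u) i), tnth h.2 i).

Lemma measurable_state_action dS dA (S : measurableType dS)
    (A : measurableType dA) u (i : 'I_u) :
  measurable_fun setT (@state_action _ _ S A u i).
Proof.
apply/measurable_fun_pairP; split.
  exact: (measurableT_comp (measurable_tnth _) measurable_fst).
exact: (measurableT_comp (measurable_tnth _) measurable_snd).
Qed.

Section marginals.
Context (T : nat) (R : realType) dS dA dW (S : measurableType dS)
  (A : measurableType dA) (W : measurableType dW).
Variables (f : {mfun (S * A * W)%type >-> S}) (p0 : probability S R)
  (q : 'I_T -> probability W R).
Implicit Types pi : policy T R S A.

Definition state_law pi u (uT : (u <= T)%N) : probability S R :=
  distribution (history_law f p0 q pi uT) (@current _ _ S A u).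

Definition state_action_law pi (t : 'I_T) : probability (S * A)%type R :=
  distribution
    (semidirect (history_law f p0 q pi (ltnW (ltn_ord t))) (pi t))
    (@current_action _ _ S A t).

(** The time bound in [history_law] is a proof term; the two proofs of it that occur here are equal
    by irrelevance. *)
Lemma state_action_lawE pi u (uT : (u < T)%N) :
  state_action_law pi (Ordinal uT) =
  distribution
    (semidirect (history_law f p0 q pi (ltnW uT)) (pi (Ordinal uT)))
    (@current_action _ _ S A u).
Proof.
by rewrite /state_action_law (bool_irrelevance (ltn_ord (Ordinal uT)) uT).
Qed.

Lemma state_action_law_fst pi (t : 'I_T) B : measurable B ->
  state_action_law pi t (fst @^-1` B) = state_law pi (ltnW (ltn_ord t)) B.
Proof.
move=> mB.
apply: (@semidirect_fst _ _ _ _ _ _ (pi t) ((@current _ _ S A t) @^-1` B)).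
exact: measurable_funPTI.
Qed.

(** The next state is drawn from a kernel that sees the past only through the current state and
    action, so the law of this pair determines the next state law. The induction over time rests on
    this. *)
Lemma state_lawS pi u (uT : (u < T)%N) B : measurable B ->
  state_law pi uT B =
  semidirect (state_action_law pi (Ordinal uT)) (transition f (q (Ordinal uT)))
    (snd @^-1` B).
Proof.
move=> mB; have m2 : measurable (snd @^-1` B : set (S * A * S)).
  by rewrite -[X in measurable X]setTI; exact: measurable_snd.
rewrite (@semidirect_map _ _ _ _ _ _ _ _ _
  (semidirect (history_law f p0 q pi (ltnW uT)) (pi (Ordinal uT)))
  (kpullback (transition f (q (Ordinal uT))) (@current_action _ _ S A u))
  _ _ (@current_action _ _ S A u) snd)//; last first.
  by move=> C mC; rewrite state_action_lawE.
rewrite /state_law /distribution /pushforward /=; congr (semidirect _ _ _).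
apply/seteqP; split => -[z x] /=.
  by rewrite /current /extend /= tnth_rcons_last.
by rewrite /current /extend /= tnth_rcons_last.
Qed.

(** Later draws have total mass 1, so the law of a recorded pair does not change when the history is
    extended. *)
Lemma history_law_state_action pi u (uT : (u <= T)%N) (i : 'I_u) C :
  measurable C ->
  history_law f p0 q pi uT (state_action i @^-1` C) =
  state_action_law pi (widen_ord uT i) C.
Proof.
move=> mC; elim: u uT i => [|u IH] uT i; first by case: i.
have mfst (B : set (history S A u)) : measurable B ->
    measurable (fst @^-1` B : set (history S A u * A)).
  by move=> mB; rewrite -[X in measurable X]setTI; exact: measurable_fst.
(* Either the pair is older than the last step, and the induction hypothesis applies, or it is the
   one just drawn. *)
case: (unliftP ord_max i) => [j ->|->].
  have jE : lift ord_max j = widen_ord (leqnSn u) j.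
    by apply/val_inj; exact: lift_max.
  have mj : measurable (state_action j @^-1` C : set (history S A u)).
    by rewrite -[X in measurable X]setTI; exact: measurable_state_action.
  rewrite jE (_ : widen_ord uT _ = widen_ord (ltnW uT) j); last exact/val_inj.
  rewrite -IH -(semidirect_fst _ (pi (Ordinal uT)) mj).
  rewrite -(semidirect_fst _ (kpullback (transition f (q (Ordinal uT)))
    (@current_action _ _ S A u)) (mfst _ mj)) /=.
  rewrite /distribution /pushforward /=; congr (semidirect _ _ _).
  apply/seteqP; split => -[[h a] x] /=; rewrite /state_action /=.
    by rewrite !tnth_rcons_widen.
  by rewrite !tnth_rcons_widen.
rewrite (_ : widen_ord uT _ = Ordinal uT); last exact/val_inj.
have mc : measurable (@current_action _ _ S A u @^-1` C).
  exact: measurable_funPTI.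
rewrite state_action_lawE /distribution /pushforward /=.
rewrite -(semidirect_fst _ (kpullback (transition f (q (Ordinal uT)))
  (@current_action _ _ S A u)) mc) /=.
congr (semidirect _ _ _).
apply/seteqP; split => -[[h a] x] /=; rewrite /state_action /=.
  by rewrite tnth_rcons_widen tnth_rcons_last.
by rewrite tnth_rcons_widen tnth_rcons_last.
Qed.

(** Let [k t] be the conditional law of the action given the state at time [t] under [pi]. For the
    policy built from [k], equal state laws at time [t] give equal pair laws, and then by
    [state_lawS] equal state laws at the next time. *)
Lemma markov_policy_state_action_law pi : disintegrable A R ->
  exists pi', [/\ markov_policy pi',
    forall u (uT : (u <= T)%N) B, measurable B ->
      state_law pi' uT B = state_law pi uT B &
    forall t C, measurable C ->
      state_action_law pi' t C = state_action_law pi t C].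
Proof.
move=> dA'.
have /choice[k kE] : forall t : 'I_T, exists k : R.-pker S ~> A,
    forall C, measurable C -> state_action_law pi t C =
      semidirect (state_law pi (ltnW (ltn_ord t))) k C.
  by move=> t; apply: dA' => B mB; exact: state_action_law_fst.
pose pi' : policy T R S A := fun t => kpullback (k t) (@current _ _ S A t).
have step (t : 'I_T) : (forall B, measurable B ->
      state_law pi' (ltnW (ltn_ord t)) B = state_law pi (ltnW (ltn_ord t)) B) ->
    forall C, measurable C -> state_action_law pi' t C = state_action_law pi t C.
  move=> eqs C mC; rewrite kE// -(@eq_semidirect _ _ _ _ _ _ _ (k t) (k t) eqs)//.
  rewrite [RHS](@semidirect_map _ _ _ _ _ _ _ _ _
    (history_law f p0 q pi' (ltnW (ltn_ord t))) (pi' t) _ _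
    (@current _ _ S A t) snd)//.
have eqs u (uT : (u <= T)%N) B : measurable B ->
    state_law pi' uT B = state_law pi uT B.
  elim: u uT B => [//|u IH] uT B mB.
  apply: (etrans (state_lawS pi' uT mB)).
  apply: (etrans _ (esym (state_lawS pi uT mB))).
  apply: eq_semidirect => [|x C _|]; first by apply: step => C; exact: IH.
    by [].
  by rewrite -[X in measurable X]setTI; exact: measurable_snd.
exists pi'; split.
- by move=> t; exists (k t).
- exact: eqs.
- by move=> t; apply: step => B; exact: eqs.
Qed.

End marginals.

(** * Expectations of quasi-integrable sums *)

(** Meant for [a], [c] the integrals of the parts of a sum, and [p], [m] the sums of the integrals
    of the parts. Finiteness of [p] passes to [a] and that of [m] to [c], which excludes an
    indeterminate difference. *)
Lemma sube_eq_of_add (R : realType) (a c p m : \bar R) :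
  0 <= a -> 0 <= c -> a <= p -> c <= m -> a + m = c + p ->
  p < +oo \/ m < +oo -> a - c = p - m.
Proof.
case: a c p m => [a| |] [c| |] [p| |] [m| |]//= _ _ _ _ acpm [] _ //;
  by move: acpm => [acpm]; rewrite -!EFinB; congr EFin; lra.
Qed.

Lemma ge0_expectation_sum d (T : measurableType d) (R : realType)
    (P : probability T R) n (X : 'I_n -> T -> R) (Y : T -> R) :
  (forall i, measurable_fun setT (X i)) -> measurable_fun setT Y ->
  (forall i w, 0 <= X i w)%R -> (forall w, 0 <= Y w)%R ->
  'E_P[fun w => (\sum_(i < n) X i w + Y w)%R] =
  \sum_(i < n) 'E_P[X i] + 'E_P[Y].
Proof.
move=> mX mY X0 Y0; rewrite unlock.
under eq_integral do rewrite EFinD -sumEFin.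
rewrite ge0_integralD//=.
- rewrite ge0_integral_sum//; first by move=> i; exact/measurable_EFinP.
  by move=> i w _; rewrite lee_fin.
- by move=> w _; apply: sume_ge0 => i _; rewrite lee_fin.
- by apply: emeasurable_sum => i; exact/measurable_EFinP.
- by move=> w _; rewrite lee_fin.
- exact/measurable_EFinP.
Qed.

(** The parts of the sum [Z] are at most the sums [Zp] and [Zm] of the parts, and
    [Z^\+ + Zm = Z^\- + Zp] pointwise. All four functions are nonnegative, so the identity can be
    integrated even when some integral is infinite; subtraction comes last. *)
Lemma expectation_sumE d (T : measurableType d) (R : realType)
    (P : probability T R) n (X : 'I_n -> T -> R) (Y : T -> R) :
  (forall i, measurable_fun setT (X i)) -> measurable_fun setT Y ->
  let p := \sum_(i < n) 'E_P[((X i)^\+)%R] + 'E_P[(Y^\+)%R] in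
  let m := \sum_(i < n) 'E_P[((X i)^\-)%R] + 'E_P[(Y^\-)%R] in
  p < +oo \/ m < +oo ->
  'E_P[fun w => (\sum_(i < n) X i w + Y w)%R] = p - m.
Proof.
move=> mX mY p m pm.
have posneg (F : T -> R) w : (F w = F^\+ w - F^\- w)%R.
  by rewrite -[in LHS](funrposBneg F).
pose Z w := (\sum_(i < n) X i w + Y w)%R.
pose Zp w := (\sum_(i < n) (X i)^\+ w + Y^\+ w)%R.
pose Zm w := (\sum_(i < n) (X i)^\- w + Y^\- w)%R.
have mZ : measurable_fun setT Z.
  by apply: measurable_funD => //; exact: measurable_sum.
have mZp : measurable_fun setT Zp.
  apply: measurable_funD; last exact: measurable_funrpos.
  by apply: measurable_sum => i; exact: measurable_funrpos.
have mZm : measurable_fun setT Zm.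
  apply: measurable_funD; last exact: measurable_funrneg.
  by apply: measurable_sum => i; exact: measurable_funrneg.
have Zp0 w : (0 <= Zp w)%R.
  by rewrite addr_ge0// ?sumr_ge0// => *; exact: funrpos_ge0.
have Zm0 w : (0 <= Zm w)%R.
  by rewrite addr_ge0// ?sumr_ge0// => *; exact: funrneg_ge0.
have ZE w : (Z w = Zp w - Zm w)%R.
  rewrite /Z /Zp /Zm opprD addrACA -sumrB; congr (_ + _)%R.
    by apply: eq_bigr => i _; exact: posneg.
  exact: posneg.
have Zmm : Z^\-%R = (fun w => Num.max (- Z w) 0)%R by [].
have pE : p = \int[P]_w (Zp w)%:E.
  rewrite /p -ge0_expectation_sum//; first by rewrite unlock.
  - by move=> i; exact: measurable_funrpos.
  - exact: measurable_funrpos.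
have mE : m = \int[P]_w (Zm w)%:E.
  rewrite /m -ge0_expectation_sum//; first by rewrite unlock.
  - by move=> i; exact: measurable_funrneg.
  - exact: measurable_funrneg.
pose a := \int[P]_w (Z^\+%R w)%:E; pose c := \int[P]_w (Z^\-%R w)%:E.
have EZ : 'E_P[Z] = a - c.
  by rewrite unlock integralE -/(EFin \o Z) funerpos funerneg.
have mZpos := measurable_funrpos mZ; have mZneg := measurable_funrneg mZ.
have ac : a + m = c + p.
  rewrite mE pE -!ge0_integralD//; try by [move=> w _; rewrite lee_fin
    | exact/measurable_EFinP].
  apply: eq_integral => w _; rewrite -!EFinD; congr EFin.
  have := posneg Z w; rewrite ZE => zz.
  lra.
have cm : c <= m.
  rewrite mE; apply: ge0_le_integral => //.
  - by move=> w _; rewrite lee_fin.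
  - exact/measurable_EFinP.
  - exact/measurable_EFinP.
  - move=> w _; rewrite lee_fin Zmm ge_max Zm0 andbT ZE opprB gerBl.
    exact: Zp0.
have ap : a <= p.
  rewrite pE; apply: ge0_le_integral => //.
  - by move=> w _; rewrite lee_fin.
  - exact/measurable_EFinP.
  - exact/measurable_EFinP.
  - move=> w _; rewrite lee_fin /funrpos ge_max Zp0 andbT ZE gerBl.
    exact: Zm0.
have c0 : 0 <= c by apply: integral_ge0 => w _; rewrite lee_fin.
have a0 : 0 <= a by apply: integral_ge0 => w _; rewrite lee_fin.
by rewrite -/Z EZ; exact: sube_eq_of_add.
Qed.

(** [X] may fail to be integrable, hence the change of variables on positive and negative parts
    separately. *)
Lemma expectation_map d d' (T : measurableType d) (T' : measurableType d')
    (R : realType) (P : probability T R) (P' : probability T' R)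
    (phi : T -> T') (X : T' -> R) :
  measurable_fun setT phi -> measurable_fun setT X ->
  (forall C, measurable C -> P' C = P (phi @^-1` C)) ->
  'E_P'[X] = 'E_P[X \o phi].
Proof.
move=> mphi mX P'E; rewrite unlock.
rewrite (eq_measure_integral (pushforward P phi)); last first.
  by move=> C mC _; exact: P'E.
rewrite integralE [RHS]integralE; congr (_ - _).
  rewrite ge0_integral_pushforward ?preimage_setT//.
    by apply: eq_integral => x _; rewrite /= !funeposE.
  by apply: measurable_funepos; exact/measurable_EFinP.
rewrite ge0_integral_pushforward ?preimage_setT//.
  by apply: eq_integral => x _; rewrite /= !funenegE.
by apply: measurable_funeneg; exact/measurable_EFinP.
Qed.

(** * The flags as a function of the history *)

(** Composites such as [unaugment (lift_policy pi)] are compared with [pi] as functions of histories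
    and sets, rather than as packed kernels; this is enough for equal laws. *)
Lemma history_law_ext (T : nat) (R : realType) dS dA dW
    (S : measurableType dS) (A : measurableType dA) (W : measurableType dW)
    (f : {mfun (S * A * W)%type >-> S}) (p0 : probability S R)
    (q : 'I_T -> probability W R) (pi pi' : policy T R S A) :
  (forall t h B, measurable B -> pi t h B = pi' t h B) ->
  forall u (uT : (u <= T)%N) C, measurable C ->
    history_law f p0 q pi uT C = history_law f p0 q pi' uT C.
Proof.
move=> pipi'; elim => [//|u IH] uT C mC.
apply: eq_semidirect => [D mD| |]; last 2 first.
- by [].
- exact: measurable_funPTI.
apply: eq_semidirect => [E mE|h B mB|//]; first exact: IH.
exact: (pipi' (Ordinal uT) h B mB).
Qed.

Section augment.
Context dX dA (X : measurableType dX) (A : measurableType dA).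
Variables (Xa : set X) (mXa : measurable Xa).

Definition alarm_raised t (h : history X A t) (i : 'I_t.+1) : bool :=
  has (fun x => x \in Xa) (take i.+1 h.1).

Definition augment t (h : history X A t) : history (X * bool)%type A t :=
  ([tuple (tnth h.1 i, alarm_raised h i) | i < t.+1], h.2).

Definition forget_flags t (h : history (X * bool)%type A t) : history X A t :=
  ([tuple (tnth h.1 i).1 | i < t.+1], h.2).

Lemma augmentK t : cancel (@augment t) (@forget_flags t).
Proof.
move=> [x a]; congr pair => /=; apply: eq_from_tnth => i.
by rewrite !tnth_mktuple.
Qed.

Lemma alarm_raisedP t (h : history X A t) (i : 'I_t.+1) :
  alarm_raised h i <-> exists2 j : 'I_t.+1, (j <= i)%N & Xa (tnth h.1 j).
Proof.
rewrite /alarm_raised; split.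
  move=> /(has_nthP (current h))[j].
  rewrite size_takel ?size_tuple// => ji; rewrite nth_take// => /set_mem xj.
  have jt : (j < t.+1)%N by rewrite (leq_trans ji).
  by exists (Ordinal jt) => //; rewrite (tnth_nth (current h)).
move=> [j ji xj]; apply/(has_nthP (current h)); exists (j : nat).
  by rewrite size_takel ?size_tuple.
by rewrite nth_take// -tnth_nth mem_set.
Qed.

Lemma alarm_raised_last t (h : history X A t) :
  (current (augment h)).2 = has (fun x => x \in Xa) h.1.
Proof.
rewrite /current /augment /= tnth_mktuple /alarm_raised /=.
by rewrite take_oversize// size_tuple.
Qed.

Lemma current_augment1 t (h : history X A t) :
  (current (augment h)).1 = current h.
Proof. by rewrite /current /augment /= tnth_mktuple. Qed.

Lemma augment_init x :
  augment (init_history A x) = init_history A (flag_init Xa x).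
Proof.
congr pair => /=; apply: eq_from_tnth => i.
by rewrite tnth_mktuple !ord1 /alarm_raised /= orbF.
Qed.

(** The recursion for the flag is recovered from its definition on prefixes: older prefixes are
    unchanged when a state is appended, and the last prefix is the whole list of states. *)
Lemma augment_extend t (h : history X A t) (a : A) (x : X) :
  augment (extend (h, a, x)) =
  extend (augment h, a, (x, (x \in Xa) || (current (augment h)).2)).
Proof.
congr pair => /=; apply: eq_from_tnth => i; rewrite tnth_mktuple.
case: (unliftP ord_max i) => [j ->|->].
  have -> : lift ord_max j = widen_ord (leqnSn t.+1) j.
    by apply/val_inj; exact: lift_max.
  rewrite !tnth_rcons_widen tnth_mktuple; congr pair.
  by rewrite /alarm_raised /= -cats1 takel_cat// size_tuple.
rewrite !tnth_rcons_last alarm_raised_last; congr pair.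
rewrite /alarm_raised /= take_oversize; last by rewrite size_rcons size_tuple.
by rewrite has_rcons.
Qed.

Lemma measurable_augment t : measurable_fun setT (@augment t).
Proof.
apply/measurable_fun_pairP; split; last exact: measurable_snd.
have mx j : measurable_fun setT (fun h : history X A t => tnth h.1 j).
  exact: (measurableT_comp (measurable_tnth _) measurable_fst).
apply/measurable_fun_tnthP => i.
rewrite (_ : _ \o _ = fun h : history X A t => (tnth h.1 i, alarm_raised h i));
  last by apply/funext => h; rewrite /= tnth_mktuple.
apply/measurable_fun_pairP; split; first exact: mx.
apply: (@measurable_fun_bool _ _ _ _ true); rewrite setTI.
rewrite (_ : _ @^-1` _ = \bigcup_(j in [set j : 'I_t.+1 | (j <= i)%N])
    (fun h : history X A t => tnth h.1 j) @^-1` Xa); last first.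
  apply/seteqP; split => h; first by move=> /alarm_raisedP[j]; exists j.
  by move=> [j ji xj]; apply/alarm_raisedP; exists j.
apply: fin_bigcup_measurable => // j _.
by rewrite -[X in measurable X]setTI; exact: mx.
Qed.

Lemma measurable_forget_flags t : measurable_fun setT (@forget_flags t).
Proof.
apply/measurable_fun_pairP; split; last exact: measurable_snd.
apply/measurable_fun_tnthP => i.
rewrite (_ : _ \o _ = fun h : history (X * bool)%type A t => (tnth h.1 i).1).
  apply: (measurableT_comp measurable_fst).
  exact: (measurableT_comp (measurable_tnth _) measurable_fst).
by apply/funext => h; rewrite /= tnth_mktuple.
Qed.

End augment.

(** Induction on time, with [semidirect_map] applied twice: for the action, drawn from the same
    kernel at the augmented history, and for the next state, whose flag is recomputed. The noise law
    is the same on both sides. *)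
Lemma history_law_augment (T : nat) (R : realType) dX dA dW
    (X : measurableType dX) (A : measurableType dA) (W : measurableType dW)
    (f : {mfun (X * A * W)%type >-> X}) (p0 : probability X R)
    (q : 'I_T -> probability W R) (Xa : set X) (mXa : measurable Xa)
    (pi_hat : policy T R (X * bool)%type A) u (uT : (u <= T)%N) C :
  measurable C ->
  history_law (augmented_dynamics f mXa) (distribution p0 (augmented_init mXa))
    q pi_hat uT C =
  history_law f p0 q
    (fun t => kpullback (pi_hat t) (mfun_of (@measurable_augment _ _ _ A _ mXa t)))
    uT (@augment _ _ X A Xa u @^-1` C).
Proof.
elim: u uT C => [|u IH] uT C mC.
  rewrite /= /distribution /pushforward /=; congr (p0 _).
  by apply/seteqP; split => x /=; rewrite augment_init.
pose phi (z : history X A u * A) := (augment Xa z.1, z.2).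
(* The new flag depends on the previous one, so [psi] takes the whole history and not the new state
   alone. *)
pose psi (y : history X A u * A * X) : X * bool :=
  (y.2, (y.2 \in Xa) || (current (augment Xa y.1.1)).2).
have mphi : measurable_fun setT phi.
  apply/measurable_fun_pairP; split; last exact: measurable_snd.
  exact: (measurableT_comp (@measurable_augment _ _ _ A _ mXa u) measurable_fst).
have mpsi : measurable_fun setT psi.
  apply/measurable_fun_pairP; split; first exact: measurable_snd.
  apply: measurable_or.
    (* The alarm test is the second component of [augmented_init], which carries its
       measurability. *)
    apply: (measurableT_comp measurable_snd
      (measurableT_comp (measurable_funPT (augmented_init mXa)) measurable_snd)).
  apply: (measurableT_comp measurable_snd).
  apply: (measurableT_comp (measurable_funPT (@current _ _ (X * bool)%type A u))).
  apply: (measurableT_comp (@measurable_augment _ _ _ A _ mXa u)).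
  exact: (measurableT_comp measurable_fst measurable_fst).
have mD : measurable (@extend _ _ (X * bool)%type A u @^-1` C).
  exact: measurable_funPTI.
have L1 D : measurable D ->
    semidirect (history_law (augmented_dynamics f mXa)
      (distribution p0 (augmented_init mXa)) q pi_hat (ltnW uT))
      (pi_hat (Ordinal uT)) D =
    semidirect (history_law f p0 q (fun t => kpullback (pi_hat t)
      (mfun_of (@measurable_augment _ _ _ A _ mXa t))) (ltnW uT))
      (kpullback (pi_hat (Ordinal uT))
        (mfun_of (@measurable_augment _ _ _ A _ mXa u))) (phi @^-1` D).
  move=> mD'; apply: (@semidirect_map _ _ _ _ _ _ _ _ _ _ _ _ _
    (@augment _ _ X A Xa u) snd) => //.
    exact: measurable_augment.
  by move=> E; exact: IH.
apply: (etrans (@semidirect_map _ _ _ _ _ _ _ _ _ _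
  (kpullback (transition f (q (Ordinal uT))) (@current_action _ _ X A u))
  _ _ phi psi mphi mpsi L1 _ _ mD)).
  move=> [h a] B mB /=; rewrite /kpullback /transition /=.
  rewrite /distribution /pushforward /=; congr (q _ _).
  by apply/seteqP; split => w; rewrite /= /next /= /flag_dynamics /=
    current_augment1.
rewrite /= /distribution /pushforward /=; congr (semidirect _ _ _).
by apply/seteqP; split => -[[h a] x] /=; rewrite augment_extend.
Qed.

(** * Objectives *)

Lemma eq_expectation d (T : measurableType d) (R : realType)
    (P Q : probability T R) (X : T -> R) :
  (forall C, measurable C -> P C = Q C) -> 'E_P[X] = 'E_Q[X].
Proof.
move=> PQ; rewrite unlock; apply: eq_measure_integral => C mC _; exact: PQ.
Qed.

Section objective.
Context (T : nat) (R : realType) dS dA dW (S : measurableType dS)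
  (A : measurableType dA) (W : measurableType dW).
Variables (f : {mfun (S * A * W)%type >-> S}) (p0 : probability S R)
  (q : 'I_T -> probability W R).
Variables (g : 'I_T -> S * A -> R) (gT : S -> R).
Hypotheses (mg : forall t, measurable_fun setT (g t))
  (mgT : measurable_fun setT gT).

Lemma measurable_stage_reward t :
  measurable_fun setT (stage_reward g t : history S A T -> R).
Proof. exact: (measurableT_comp (mg t) (measurable_state_action t)). Qed.

Lemma measurable_terminal_reward :
  measurable_fun setT (terminal_reward gT : history S A T -> R).
Proof.
exact: (measurableT_comp mgT (measurable_funPT (@current _ _ S A T))).
Qed.

Lemma expectation_state_action pi t (h : S * A -> R) :
  measurable_fun setT h ->
  'E_(trajectory_law f p0 q pi)[h \o state_action t] =
  'E_(state_action_law f p0 q pi t)[h].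
Proof.
move=> mh; apply/esym; apply: expectation_map => //.
  exact: measurable_state_action.
move=> C mC; rewrite /trajectory_law history_law_state_action//.
by congr (state_action_law _ _ _ _ _ _); exact/val_inj.
Qed.

Lemma expectation_terminal_state pi (h : S -> R) :
  measurable_fun setT h ->
  'E_(trajectory_law f p0 q pi)[h \o @current _ _ S A T] =
  'E_(state_law f p0 q pi (leqnn T))[h].
Proof. by move=> mh; apply/esym; exact: expectation_map. Qed.

(** Well-definedness lets the expectation of the sum be split, after which only laws at single times
    appear; [eq_objective] rests on this. *)
Lemma objectiveE pi : objective_well_defined f p0 q g gT pi ->
  objective f p0 q g gT pi =
  (\sum_(t < T) 'E_(state_action_law f p0 q pi t)[((g t)^\+)%R] +
    'E_(state_law f p0 q pi (leqnn T))[(gT^\+)%R]) -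
  (\sum_(t < T) 'E_(state_action_law f p0 q pi t)[((g t)^\-)%R] +
    'E_(state_law f p0 q pi (leqnn T))[(gT^\-)%R]).
Proof.
move=> wd; rewrite /objective expectation_sumE//.
- congr (_ - _); congr (_ + _).
  + apply: eq_bigr => t _; apply: expectation_state_action.
    exact: measurable_funrpos.
  + by apply: expectation_terminal_state; exact: measurable_funrpos.
  + apply: eq_bigr => t _; apply: expectation_state_action.
    exact: measurable_funrneg.
  + by apply: expectation_terminal_state; exact: measurable_funrneg.
- exact: measurable_stage_reward.
- exact: measurable_terminal_reward.
Qed.

Lemma eq_objective pi pi' :
  objective_well_defined f p0 q g gT pi ->
  objective_well_defined f p0 q g gT pi' ->
  (forall t C, measurable C ->
    state_action_law f p0 q pi t C = state_action_law f p0 q pi' t C) ->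
  (forall B, measurable B -> state_law f p0 q pi (leqnn T) B =
    state_law f p0 q pi' (leqnn T) B) ->
  objective f p0 q g gT pi = objective f p0 q g gT pi'.
Proof.
move=> wd wd' eqsa eqs; rewrite !objectiveE//.
congr (_ - _); congr (_ + _).
- by apply: eq_bigr => t _; apply: eq_expectation; exact: eqsa.
- by apply: eq_expectation; exact: eqs.
- by apply: eq_bigr => t _; apply: eq_expectation; exact: eqsa.
- by apply: eq_expectation; exact: eqs.
Qed.

End objective.

(** * Policies of the original and of the augmented system *)

Section augmented_values.
Context (T : nat) (R : realType) dX dA dW (X : measurableType dX)
  (A : measurableType dA) (W : measurableType dW).
Variables (f : {mfun (X * A * W)%type >-> X}) (p0 : probability X R)
  (q : 'I_T -> probability W R) (Xa : set X) (mXa : measurable Xa).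
Variables (g : 'I_T -> X * A -> R) (gT : X -> R).
Hypotheses (mg : forall t, measurable_fun setT (g t))
  (mgT : measurable_fun setT gT).

Definition flag_raised : set (history (X * bool)%type A T) :=
  [set h | (tnth h.1 ord_max).2 = true].

Definition alarm_triggered : set (history X A T) :=
  [set h | exists t : 'I_T.+1, Xa (tnth h.1 t)].

Definition augmented_reward (t : 'I_T) (ya : X * bool * A) : R :=
  g t (ya.1.1, ya.2).

Definition augmented_terminal (y : X * bool) : R := gT y.1.

Let f_hat := augmented_dynamics f mXa.
Let p0_hat := distribution p0 (augmented_init mXa).

Definition unaugment (pi : policy T R (X * bool)%type A) : policy T R X A :=
  fun t => kpullback (pi t) (mfun_of (@measurable_augment _ _ _ A _ mXa t)).

Definition lift_policy (pi : policy T R X A) : policy T R (X * bool)%type A :=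
  fun t => kpullback (pi t) (mfun_of (@measurable_forget_flags _ _ X A t)).

Lemma measurable_snd_true :
  measurable [set y : X * bool | y.2 = true].
Proof.
rewrite -[X in measurable X]setTI.
exact: (@measurable_snd _ _ X bool measurableT [set true]).
Qed.

Lemma measurable_flag_raised : measurable flag_raised.
Proof.
exact: (measurable_funPTI (@current _ _ (X * bool)%type A T)
  measurable_snd_true).
Qed.

Lemma measurable_augmented_reward t : measurable_fun setT (augmented_reward t).
Proof.
apply: (measurableT_comp (mg t)); apply/measurable_fun_pairP; split.
  exact: (measurableT_comp measurable_fst measurable_fst).
exact: measurable_snd.
Qed.

Lemma measurable_augmented_terminal : measurable_fun setT augmented_terminal.
Proof. exact: (measurableT_comp mgT measurable_fst). Qed.

Lemma augment_flag_raised :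
  @augment _ _ X A Xa T @^-1` flag_raised = alarm_triggered.
Proof.
apply/seteqP; split => h; rewrite /flag_raised /alarm_triggered /=.
  by rewrite tnth_mktuple /= => /alarm_raisedP[j _ Xj]; exists j.
move=> [j Xj]; rewrite tnth_mktuple /=; apply/alarm_raisedP; exists j => //=.
by rewrite -ltnS.
Qed.

Lemma flag_raised_unaugment pi :
  trajectory_law f_hat p0_hat q pi flag_raised =
  trajectory_law f p0 q (unaugment pi) alarm_triggered.
Proof.
rewrite -augment_flag_raised /trajectory_law.
by apply: history_law_augment; exact: measurable_flag_raised.
Qed.

Lemma objective_unaugment pi :
  objective f_hat p0_hat q augmented_reward augmented_terminal pi =
  objective f p0 q g gT (unaugment pi).
Proof.
rewrite /objective (@expectation_map _ _ _ _ _
  (trajectory_law f p0 q (unaugment pi)) _ (@augment _ _ X A Xa T)).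
- congr expectation; apply/funext => h /=; congr (_ + _)%R.
    apply: eq_bigr => t _; rewrite /stage_reward /augmented_reward /=.
    by rewrite tnth_mktuple.
  by rewrite /terminal_reward /augmented_terminal /= tnth_mktuple.
- exact: measurable_augment.
- apply: measurable_funD.
    apply: measurable_sum => t; apply: measurable_stage_reward.
    exact: measurable_augmented_reward.
  by apply: measurable_terminal_reward; exact: measurable_augmented_terminal.
- by move=> C mC; exact: history_law_augment.
Qed.

(** The other composite need not give back the policy: an augmented policy may act differently on
    flags that contradict the states. In that direction only laws of trajectories are compared. *)
Lemma lift_policyK pi t h B : unaugment (lift_policy pi) t h B = pi t h B.
Proof. by rewrite /unaugment /lift_policy /= /kpullback /= augmentK. Qed.

Lemma trajectory_law_lift pi C : measurable C ->
  trajectory_law f p0 q (unaugment (lift_policy pi)) C =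
  trajectory_law f p0 q pi C.
Proof.
by move=> mC; apply: history_law_ext => // t h B _; exact: lift_policyK.
Qed.

Lemma objective_lift pi :
  objective f_hat p0_hat q augmented_reward augmented_terminal (lift_policy pi) =
  objective f p0 q g gT pi.
Proof.
rewrite objective_unaugment; apply: eq_expectation => C.
exact: trajectory_law_lift.
Qed.

Lemma flag_raised_lift pi :
  trajectory_law f_hat p0_hat q (lift_policy pi) flag_raised =
  trajectory_law f p0 q pi alarm_triggered.
Proof.
rewrite flag_raised_unaugment; apply: trajectory_law_lift.
rewrite -augment_flag_raised -[X in measurable X]setTI.
by apply: measurable_augment => //; exact: measurable_flag_raised.
Qed.

(** The flag turns the constraint into an event about the terminal state alone, so a policy with the
    same one-time laws keeps both the objective and the constraint probability. *)
Lemma exists_markov_policy pi : disintegrable A R ->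
  (forall pi, objective_well_defined f_hat p0_hat q augmented_reward
    augmented_terminal pi) ->
  exists pi', [/\ markov_policy pi',
    objective f_hat p0_hat q augmented_reward augmented_terminal pi' =
    objective f_hat p0_hat q augmented_reward augmented_terminal pi &
    trajectory_law f_hat p0_hat q pi' flag_raised =
    trajectory_law f_hat p0_hat q pi flag_raised].
Proof.
move=> dA' wd.
have [pi' [mpi eqs eqsa]] := markov_policy_state_action_law f_hat p0_hat q pi dA'.
exists pi'; split => //.
  apply: eq_objective => //.
  - exact: measurable_augmented_reward.
  - exact: measurable_augmented_terminal.
  - by move=> B mB; exact: eqs.
exact: (eqs T (leqnn T) _ measurable_snd_true).
Qed.

End augmented_values.
Theorem theorem1 (R : realType) (n m l T : nat) (T_ge1 : (1 <= T)%N)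
  (X : set (borel_rV R n)) (mX : measurable X) (X0 : X !=set0)
  (A : set (borel_rV R m)) (mA : measurable A) (A0 : A !=set0)
  (W : set (borel_rV R l)) (mW : measurable W) (W0 : W !=set0)
  (f : {mfun (borel_sub X0 * borel_sub A0 * borel_sub W0)%type >-> borel_sub X0})
  (p0 : probability (borel_sub X0) R)
  (q : 'I_T -> probability (borel_sub W0) R)
  (Xa : set (borel_sub X0)) (mXa : measurable Xa)
  (g : 'I_T -> borel_sub X0 * borel_sub A0 -> R)
  (mg : forall t : 'I_T, measurable_fun setT (g t))
  (gT : borel_sub X0 -> R) (mgT : measurable_fun setT gT)
  (Delta : R) (Delta_ge0 : (0 <= Delta)%R) :
  let Pi := policy T R (borel_sub X0) (borel_sub A0) in
  let Pi_hat := policy T R (borel_sub X0 * bool)%type (borel_sub A0) in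
  let f_hat := augmented_dynamics f mXa in
  let p0_hat := distribution p0 (augmented_init mXa) in
  let g_hat := fun (t : 'I_T) (ya : borel_sub X0 * bool * borel_sub A0) =>
    g t (ya.1.1, ya.2) in
  let gT_hat := fun y : borel_sub X0 * bool => gT y.1 in
  let P := trajectory_law f p0 q in
  let P_hat := trajectory_law f_hat p0_hat q in
  let J := objective f p0 q g gT in
  let J_hat := objective f_hat p0_hat q g_hat gT_hat in
  forall
    (J_wd : forall pi : Pi, objective_well_defined f p0 q g gT pi)
    (J_hat_wd : forall pi : Pi_hat,
       objective_well_defined f_hat p0_hat q g_hat gT_hat pi),
  let alarm := [set h : history (borel_sub X0) (borel_sub A0) T |
    exists t : 'I_T.+1, Xa (tnth h.1 t)] in
  let flag := [set h : history (borel_sub X0 * bool)%type (borel_sub A0) T |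
    (tnth h.1 ord_max).2 = true] in
  let value_history :=
    ereal_sup [set J pi | pi in [set pi : Pi | P pi alarm <= Delta%:E]] in
  let value_aug_history :=
    ereal_sup [set J_hat pi | pi in
      [set pi : Pi_hat | P_hat pi flag <= Delta%:E]] in
  let value_aug_markov :=
    ereal_sup [set J_hat pi | pi in
      [set pi : Pi_hat | markov_policy pi /\ P_hat pi flag <= Delta%:E]] in
  value_history = value_aug_history /\ value_aug_history = value_aug_markov.
Proof.
move=> Pi Pi_hat f_hat p0_hat g_hat gT_hat P P_hat J J_hat J_wd J_hat_wd.
move=> alarm flag value_history value_aug_history value_aug_markov.
split.
  (* The two sets of attained values coincide: [lift_policy] and [unaugment] both keep the objective
     and the constraint probability. *)
  congr ereal_sup; apply/seteqP; split => v [pi /= piD <-].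
    exists (lift_policy pi) => /=.
      by move: piD; rewrite /P -(flag_raised_lift _ _ _ mXa).
    exact: objective_lift.
  exists (unaugment mXa pi) => /=.
    by move: piD; rewrite /P_hat (flag_raised_unaugment _ _ _ mXa).
  by apply/esym; exact: objective_unaugment.
congr ereal_sup; apply/seteqP; split => v [pi /= piD <-]; last first.
  by exists pi => //; case: piD.
(* This is the inclusion with content: a feasible policy is replaced by a Markov one with the same
   objective and the same constraint probability. *)
have [pi' [mpi Jpi flagpi]] := exists_markov_policy mg mgT pi
  (disintegrable_borel_sub mA) J_hat_wd.
by exists pi' => //=; split => //; rewrite /P_hat flagpi.
Qed.
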